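(* Let $G$ be a strongly connected signed digraph on $[n]$ without positive cycles which is not a cycle. Then at least one and-or-net on $G$ has a synchronizing word of length at most $5n(\sqrt{2})^n$.
   Context: A signed digraph on $V$ is $(V,E)$ with $E\subseteq V\times V\times\{-1,1\}$ (arc from $j$ to $i$ of sign $s$; loops allowed, both signs between the same pair allowed). Cycles have no repeated vertices (a loop is a cycle); the sign of a cycle is the product of its arc signs. ''$G$ is a cycle'' means $G$ itself is a single cycle. A Boolean network (BN) is $f:\{0,1\}^V\to\{0,1\}^V$; its signed interaction digraph has a positive (negative) arc from $j$ to $i$ iff for some $x$ with $x_j=0$, $f_i(x+e_j)-f_i(x)$ is positive (negative). A BN on $G$ is one whose signed interaction digraph is $G$. An and-or-net on $G$ is a BN on $G$ in which each $f_i$ is a conjunction ($f_i(x)=1$ iff $x_j=1$ for all positive in-neighbors $j$ and $x_j=0$ for all negative in-neighbors $j$ of $i$) or a disjunction ($f_i(x)=0$ iff $x_j=0$ for all positive and $x_j=1$ for all negative in-neighbors $j$). $f^i(x)$ is $x$ with $x_i$ replaced by $f_i(x)$; $f^{i_1\cdots i_\ell}=f^{i_\ell}\circ\cdots\circ f^{i_1}$; a word $w$ is synchronizing for $f$ if $f^w$ is constant. *)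

(* Defs.v *)
From mathcomp Require Import all_boot.
Set Implicit Arguments. Unset Strict Implicit. Unset Printing Implicit Defensive.

(* Vertices are 'I_n.  An arc (j, i, s) goes from j to i with sign s,
   where s = true encodes +1 and s = false encodes -1. *)
Definition arc n := ('I_n * 'I_n * bool)%type.
Definition sdigraph n := {set arc n}.

Definition arc_tail n (a : arc n) : 'I_n := a.1.1.
Definition arc_head n (a : arc n) : 'I_n := a.1.2.
Definition arc_sign n (a : arc n) : bool := a.2.

Definition is_cycle n (G : sdigraph n) (c : seq (arc n)) : Prop :=
  [/\ c != [::], all (fun a => a \in G) c,
      cycle [rel a b | arc_head a == arc_tail b] c
    & uniq (map (@arc_tail n) c)].

(* the sign of a cycle is the product of its arc signs *)
Definition positive_cycle n (c : seq (arc n)) : Prop :=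
  ~~ odd (count (fun a => ~~ arc_sign a) c).

Definition no_positive_cycle n (G : sdigraph n) : Prop :=
  forall c, is_cycle G c -> ~ positive_cycle c.

Definition graph_is_cycle n (G : sdigraph n) : Prop :=
  exists c, [/\ is_cycle G c, G = [set a in c] &
                forall v : 'I_n, v \in map (@arc_tail n) c].

Definition adj n (G : sdigraph n) : rel 'I_n :=
  fun j i => [exists s, (j, i, s) \in G].

Definition strongly_connected n (G : sdigraph n) : Prop :=
  forall u v : 'I_n, connect (adj G) u v.

Definition config n := {ffun 'I_n -> bool}.
Definition BN n := config n -> config n.

Definition setc n (x : config n) (j : 'I_n) (b : bool) : config n :=
  [ffun k => if k == j then b else x k].

Definition interaction_arc n (f : BN n) (j i : 'I_n) (s : bool) : Prop :=
  exists x : config n, x j = false /\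
    (if s then (f x i == false) && (f (setc x j true) i == true)
          else (f x i == true) && (f (setc x j true) i == false)).

Definition BN_on n (G : sdigraph n) (f : BN n) : Prop :=
  forall j i s, (j, i, s) \in G <-> interaction_arc f j i s.

Definition is_conjunction n (G : sdigraph n) (f : BN n) (i : 'I_n) : Prop :=
  forall x : config n,
    f x i = true <-> (forall j s, (j, i, s) \in G -> x j = s).

Definition is_disjunction n (G : sdigraph n) (f : BN n) (i : 'I_n) : Prop :=
  forall x : config n,
    f x i = false <-> (forall j s, (j, i, s) \in G -> x j = ~~ s).

Definition and_or_net n (G : sdigraph n) (f : BN n) : Prop :=
  BN_on G f /\ forall i, is_conjunction G f i \/ is_disjunction G f i.

Definition upd n (f : BN n) (i : 'I_n) (x : config n) : config n :=
  setc x i (f x i).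

Definition upd_word n (f : BN n) (w : seq 'I_n) (x : config n) : config n :=
  foldl (fun y i => upd f i y) x w.

Definition synchronizing n (f : BN n) (w : seq 'I_n) : Prop :=
  exists y : config n, forall x, upd_word f w x = y.

(* Main.v *)
(* In fact a word of length at most 5n suffices.  Choose a cycle C through a root
   i such that all vertices are reached when one starts from i and repeatedly
   adds a vertex v outside C once some in-neighbour of v has been added, and a
   vertex v of C once all its in-neighbours have been.  Such a pair (C, i) exists:
   if the process is stuck at Y, there is a cycle outside Y that can be rerooted
   so as to reach Y and one vertex more.
   Switch signs so that every vertex is reached from i by positive arcs.  Since
   all cycles are negative, the positive arcs form an acyclic graph, all arcs into
   i are negative, and all arcs into C - i are positive.  In the switched
   coordinates take disjunctions on C - i and conjunctions elsewhere, so i is a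
   NOR, and let T be a topological order of the positive arcs, without i.
   Applying T from a state with i off switches everything off.  From a state with
   i on it switches C on, so that updating i then switches i off.  From the state
   where only i is on, it switches on every vertex with a positive path to an
   in-neighbour of i.  Since G is not a cycle, some p in C has two in-neighbours
   a, b, where a is not a positive ancestor of b.  If Q is the part of C from p to
   its last vertex before i, the word T i T i T' Q i T, where T' is T restricted
   to the positive ancestors of b, synchronizes: before Q either a or b is on, so
   Q i switches i off from every state. *)
Require Import Defs.
From mathcomp Require Import all_boot zify.
Set Implicit Arguments. Unset Strict Implicit. Unset Printing Implicit Defensive.

(** * Choosing the cycle and its root *)

Section Closure.
Variables (V : finType) (step : seq V -> pred V) (i : V).

(** The head of [L] is the vertex added last; [i] is present from the start. *)
Fixpoint built (L : seq V) : bool :=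
  if L is v :: L' then [&& built L', v \notin i :: L' & step (i :: L') v]
  else true.

Lemma built_uniq L : built L -> uniq (i :: L).
Proof.
elim: L => [|v L IH] //= /and3P[/IH /= /andP[iL uL]].
by rewrite !inE !negb_or uL eq_sym => /andP[-> ->] _; rewrite iL.
Qed.

Lemma built_size L : built L -> size L < #|V|.
Proof.
by move/built_uniq/card_uniqP => /= <-; apply: max_card.
Qed.

Lemma built_maximal : exists2 L, built L &
  forall v, v \notin i :: L -> ~~ step (i :: L) v.
Proof.
suff H k L : built L -> #|V| - size L <= k ->
    exists2 L, built L & forall v, v \notin i :: L -> ~~ step (i :: L) v.
  exact: (H #|V| [::] isT (leq_subr _ _)).
elim: k L => [|k IH] L bL.
  by rewrite leqn0 subn_eq0 leqNgt built_size.
move=> le; case: (pickP [pred v | (v \notin i :: L) && step (i :: L) v]).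
  move=> v /andP[vL sv]; apply: (IH (v :: L)); first by rewrite /= bL vL sv.
  by rewrite /= subnS; move: le; case: (_ - _).
move=> H; exists L => // v vL; move: (H v); rewrite /= vL /= => -> //.
Qed.

End Closure.

(** * Enlarging the closure of a rooted cycle *)

Section Cycles.
Variables (V : finType) (e : rel V).
Hypothesis e_conn : forall u v, connect e u v.

(** A cycle is stored as a root [i] and the remaining vertices [P] in order; a loop has [P]
    empty. *)
Definition is_vcycle i P := [/\ path e i P, e (last i P) i & uniq (i :: P)].

Definition ear_step (P : seq V) (Y : seq V) (v : V) : bool :=
  if v \in P then [forall u, e u v ==> (u \in Y)]
  else [exists u, e u v && (u \in Y)].

Lemma path_outside (Y : pred V) p P : path e p P -> ~~ Y p ->
  (forall v u, v \in P -> Y v -> e u v -> Y u) -> forall v, v \in P -> ~~ Y v.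
Proof.
elim: P p => [|q P IH] p //= /andP[epq pP] Yp H v.
have Yq : ~~ Y q by apply: contra Yp => Yq; apply: (H q p); rewrite ?mem_head.
rewrite inE => /predU1P[-> //|vP]; apply: (IH q) => // w u wP; apply: H.
by rewrite inE wP orbT.
Qed.

(** A path from [i] to [v], traced backwards, stays outside [Y] until it meets [S], and it must meet
    [S] since [i] is in [Y]. *)
Lemma enter_path (Y : pred V) (S : seq V) i : Y i ->
  (forall u v, e u v -> ~~ Y v -> v \notin S -> ~~ Y u) ->
  forall v, ~~ Y v -> exists c Q, [/\ c \in S, path e c Q, last c Q = v, uniq Q &
     forall w, w \in Q -> ~~ Y w && (w \notin S)].
Proof.
move=> Yi H v Yv; have /connectP[R pR ev] := e_conn i v.
suff [c [Q [cS pQ lQ hQ]]] : exists c Q, [/\ c \in S, path e c Q, last c Q = v &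
     forall w, w \in Q -> ~~ Y w && (w \notin S)].
  case/shortenP: pQ lQ => Q' pQ' /= /andP[_ uQ'] sQ lQ; exists c, Q'.
  by split => // w /sQ /hQ.
elim/last_ind: R v pR ev Yv => [|R v' IH] v pR ev Yv.
  by rewrite ev /= Yi in Yv.
move: pR ev; rewrite rcons_path last_rcons => /andP[pR ev'] evv; rewrite -evv in ev'.
case vS : (v \in S); first by exists v, [::].
have Yu : ~~ Y (last i R) by apply: (H _ v); rewrite ?vS.
have [c [Q [cS pQ lQ hQ]]] := IH _ pR (erefl _) Yu.
exists c, (rcons Q v); split; rewrite ?rcons_path ?pQ ?lQ ?last_rcons //.
by move=> w; rewrite mem_rcons inE => /predU1P[->|/hQ //]; rewrite Yv vS.
Qed.

Lemma has_pred i v : v != i -> exists u, e u v.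
Proof.
move=> vi; have /connectP[R] := e_conn i v.
case/lastP: R => [_ /= ev|R w]; first by rewrite ev eqxx in vi.
by rewrite rcons_path last_rcons => /andP[_ ew] ->; exists (last i R).
Qed.

(* If the closure is stuck at Y, some cycle avoiding Y, rerooted at the vertex
   where it meets the old cycle, reaches Y and its own root. *)
Lemma enlarge_closure i P L : is_vcycle i P -> built (ear_step P) i L ->
  (forall v, v \notin i :: L -> ~~ ear_step P (i :: L) v) ->
  (exists v, v \notin i :: L) ->
  exists c Q, is_vcycle c Q /\ forall M,
    (forall v, v \notin c :: M -> ~~ ear_step Q (c :: M) v) ->
    {subset c :: i :: L <= c :: M} /\ c \notin i :: L.
Proof.
move=> [pP lP uP] bL stuck [z zL].
pose Y : pred V := fun v => v \in i :: L.
have Yi : Y i by rewrite /Y mem_head.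
have stuckE u v : e u v -> ~~ Y v -> v \notin P -> ~~ Y u.
  move=> euv Yv vP; apply: contra (stuck v Yv) => Yu; rewrite /ear_step (negPf vP).
  by apply/existsP; exists u; rewrite euv.
have PY : forall v u, v \in P -> Y v -> e u v -> Y u.
  move=> v u vP; rewrite /Y inE => /predU1P[vi|].
    by move: uP; rewrite /= -vi vP.
  move=> vL euv; clear -bL vL euv vP.
  elim: L bL vL => //= w L IH /and3P[bL wL sw]; rewrite inE => /predU1P[ev|vL].
    move: sw; rewrite /ear_step -ev vP => /forallP/(_ u); rewrite euv /=.
    by rewrite !inE => /orP[->|->] //; rewrite !orbT.
  by move: (IH bL vL); rewrite !inE => /orP[->|->] //; rewrite !orbT.
(* If all of [P] lay in [Y], no arc could leave [Y] and [z] would be unreachable from [i]. *)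
have [p pinP pY] : exists2 p, p \in P & ~~ Y p.
  case: (altP (@allP _ Y P)) => [H|/allPn[p]]; last by exists p.
  have /connectP[R pR ez] := e_conn i z.
  suff aux x R' : path e x R' -> Y x -> Y (last x R').
    by case/negP: zL; rewrite ez; apply: aux.
  elim: R' x => //= w R' IH x /andP[exw pR'] Yx; apply: IH => //.
  apply/negPn/negP => Yw.
  by case/negP: (stuckE _ _ exw Yw (contra (H w) Yw)).
have [P1 [p0 [P2 [eP P1Y p0Y]]]] : exists P1 p0 P2,
    [/\ P = P1 ++ p0 :: P2, all Y P1 & ~~ Y p0].
  have hp : has (predC Y) P by apply/hasP; exists p.
  case/split_find: hp => x s1 s2 Yx /hasPn hs.
  exists s1, x, s2; split; rewrite ?cat_rcons //.
  by apply/allP => w /hs; rewrite /= negbK.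
clear p pinP pY; move: pP lP uP PY stuckE stuck bL; rewrite eP cat_path /=.
set P' := P1 ++ _; move=> /and3P[pP1 eP1 pP2]; rewrite {1}/P' last_cat /= => lP uP PY stuckE stuck bL.
have p0P' : p0 \in P' by rewrite mem_cat mem_head orbT.
have [u eup Yu] : exists2 u, e u p0 & ~~ Y u.
  have := stuck _ p0Y; rewrite /ear_step p0P' => /forallPn[u]; rewrite negb_imply => /andP[eu Yu].
  by exists u.
have P2Y : forall v, v \in p0 :: P2 -> ~~ Y v.
  move=> v; rewrite inE => /predU1P[-> //|]; apply: (path_outside pP2 p0Y).
  by move=> x y xP; apply: PY; rewrite mem_cat inE xP !orbT.
have stuckS x v : e x v -> ~~ Y v -> v \notin p0 :: P2 -> ~~ Y x.
  move=> exv Yv vS; apply: (stuckE _ v) => //; rewrite mem_cat negb_or vS andbT.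
  by apply: contra Yv => /(allP P1Y).
(* The new cycle runs from [c] along [Q] to [u], then to [p0] and along the old cycle back to
   [c]. *)
have [c [Q [cS pQ lQ uQ hQ]]] := enter_path Yi stuckS Yu.
have pu : path e u (p0 :: P2) by rewrite /= eup.
have lu : e (last u (p0 :: P2)) i by [].
have uS : uniq (p0 :: P2).
  by move: uP; rewrite /= cat_uniq => /and3P[_ _ /andP[_]].
have Yc : ~~ Y c by apply: P2Y.
have iP' : i \notin p0 :: P2 by apply/negP => /P2Y; rewrite Yi.
move: (p0 :: P2) cS hQ pu lu uS P2Y iP' {stuckS} => S /splitPr[A B] hQ.
rewrite cat_path last_cat /= => /and3P[pA eAc pB] lB uS SY iS.
exists c, (Q ++ A).
have QAY v : v \in Q ++ A -> ~~ Y v.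
  rewrite mem_cat => /orP[/hQ/andP[] //|vA]; apply: SY.
  by rewrite mem_cat vA.
have BQA v : v \in rcons B i -> v \notin Q ++ A.
  rewrite mem_rcons inE => /predU1P[->|vB]; first by apply/negP => /QAY; rewrite Yi.
  rewrite mem_cat negb_or; apply/andP; split.
    by apply/negP => /hQ/andP[_]; rewrite mem_cat inE vB !orbT.
  apply/negP => vA; move: uS; rewrite cat_uniq => /and3P[_ /hasPn/(_ v)].
  by rewrite inE vB orbT vA => /(_ isT).
split.
  split; rewrite ?cat_path ?last_cat ?pQ ?lQ //=.
  rewrite mem_cat negb_or cat_uniq uQ /=.
  move: uS; rewrite cat_uniq /= => /and4P[-> /norP[-> _] _ _].
  rewrite andbT /=; apply/andP; split.
    by apply/negP => /hQ/andP[_]; rewrite mem_cat inE eqxx orbT.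
  rewrite andbT; apply/hasPn => w wA; apply/negP => /hQ/andP[_]; by rewrite mem_cat wA.
move=> M stM; split => //.
(* Off the new cycle one in-neighbour suffices. The rest of the old cycle from [c] to [i], and then
   [L], avoid [Q ++ A], so all of it is reached. *)
have grow x v : e x v -> x \in c :: M -> v \notin Q ++ A -> v \in c :: M.
  move=> exv xM vQA; apply/negPn/negP => vM; case/negP: (stM v vM).
  by rewrite /ear_step (negPf vQA); apply/existsP; exists x; rewrite exv.
have iM : i \in c :: M.
  have: path e c (rcons B i) by rewrite rcons_path pB.
  rewrite -{2}[i](last_rcons c B); have := mem_head c M.
  elim: (rcons B i) {1 3 4}c BQA => //= w R IH x H xM /andP[exw pR].
  apply: IH => //; first by move=> v vR; apply: H; rewrite inE vR orbT.
  by apply: grow exw xM _; apply: H; rewrite mem_head.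
suff LM : {subset L <= c :: M}.
  by move=> v; rewrite inE => /predU1P[->|]; rewrite ?mem_head // inE => /predU1P[->|/LM].
have LY v : v \in L -> Y v by rewrite /Y inE => ->; rewrite orbT.
clearbody Y; elim: L bL LY {stuck zL} => //= v L IH /and3P[bL vL sv] LY w.
have Lsub : {subset i :: L <= c :: M}.
  move=> x; rewrite inE => /predU1P[->//|]; apply: IH => // y yL.
  by apply: LY; rewrite inE yL orbT.
rewrite inE => /predU1P[->|wL]; last by apply: Lsub; rewrite inE wL orbT.
have vi : v != i by move: vL; rewrite inE => /norP[].
have [x exv xL] : exists2 x, e x v & x \in i :: L.
  move: sv; rewrite /ear_step; case: ifP => _; last first.
    by case/existsP => x /andP[exv xL]; exists x.
  have [x exv] := has_pred vi; move/forallP/(_ x); rewrite exv => xL.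
  by exists x.
by apply: (grow x) => //; [apply: Lsub | apply/negP => /QAY; rewrite LY ?mem_head].
Qed.

(** Each enlargement gains at least the new root, so the process ends, and it can only end when
    every vertex is reached. *)
Lemma complete_closure i P : is_vcycle i P ->
  exists c Q L, [/\ is_vcycle c Q, built (ear_step Q) c L & forall v, v \in c :: L].
Proof.
suff H k' j R M : #|V| - size M <= k' -> is_vcycle j R -> built (ear_step R) j M ->
    (forall v, v \notin j :: M -> ~~ ear_step R (j :: M) v) ->
    exists c Q L, [/\ is_vcycle c Q, built (ear_step Q) c L & forall v, v \in c :: L].
  move=> cP; have [L bL sL] := built_maximal (ear_step P) i.
  exact: (H _ _ _ _ (leqnn _) cP bL sL).
elim: k' j R M => [|k' IH] j R M.
  by rewrite leqn0 subn_eq0 => le _ /built_size; rewrite ltnNge le.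
move=> le cR bM sM; case: (pickP [pred v | v \notin j :: M]) => [v vM|all_in].
  have [c [Q [cQ H]]] := enlarge_closure cR bM sM (ex_intro _ v vM).
  have [N bN sN] := built_maximal (ear_step Q) c.
  have [sub cM] := H N sN; apply: (IH c Q N) => //.
  have uM : uniq [:: c, j & M] by rewrite cons_uniq cM (built_uniq bM).
  have /= := uniq_leq_size uM sub; rewrite ltnS => lt.
  by rewrite -ltnS (leq_trans _ le) // ltn_sub2l // (built_size bM).
by exists j, R, M; split => // v; have /negbFE := all_in v.
Qed.
End Cycles.

(** * Signs of cycles and switching *)

Fixpoint path_parity (V : Type) (e : rel V) (x : V) (P : seq V) : bool :=
  if P is y :: P' then e x y (+) path_parity e y P' else false.

Lemma path_parity_cat (V : Type) (e : rel V) x P Q :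
  path_parity e x (P ++ Q) = path_parity e x P (+) path_parity e (last x P) Q.
Proof. by elim: P x => //= y P IH x; rewrite IH addbA. Qed.

Section Signs.
Variables (n : nat) (G : sdigraph n).
Hypotheses (G_conn : strongly_connected G) (G_neg : no_positive_cycle G).
Local Notation V := 'I_n.

Definition sgn : rel V := fun u v => (u, v, true) \in G.

Lemma sgn_arc u v : adj G u v -> (u, v, sgn u v) \in G.
Proof.
by case/existsP=> -[] uv; rewrite /sgn ?uv //; case E: ((u, v, true) \in G).
Qed.

Definition arcs_of (x : V) P := pairmap (fun u v => (u, v, sgn u v)) x P.

Lemma arcs_of_in x P : path (adj G) x P -> all (fun a => a \in G) (arcs_of x P).
Proof. by elim: P x => //= y P IH x /andP[/sgn_arc -> /IH ->]. Qed.

Lemma arcs_of_path (a : Defs.arc n) x z s P : arc_head a = x ->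
  path [rel a b | arc_head a == arc_tail b] a
    (rcons (arcs_of x P) (last x P, z, s)).
Proof.
elim: P a x => [|y P IH] a x ax /=; first by rewrite /arc_tail /= ax eqxx.
by rewrite /arc_tail /= ax eqxx IH.
Qed.

Lemma arcs_of_tails x P : map (@arc_tail n) (arcs_of x P) = belast x P.
Proof. by elim: P x => //= y P IH x; rewrite IH. Qed.

Lemma arcs_of_parity x P :
  odd (count (fun a => ~~ arc_sign a) (arcs_of x P)) =
  path_parity (fun u v => ~~ sgn u v) x P.
Proof. by elim: P x => //= y P IH x; rewrite oddD IH oddb. Qed.

Lemma is_cycle_arcs x P s : path (adj G) x P -> (last x P, x, s) \in G ->
  uniq (x :: P) -> is_cycle G ((last x P, x, s) :: arcs_of x P).
Proof.
move=> pP lP; rewrite lastI rcons_uniq => /andP[ul uP].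
split => //; first by rewrite /= lP arcs_of_in.
  exact: arcs_of_path.
by rewrite /= arcs_of_tails ul.
Qed.

Lemma cycle_parity x P s : path (adj G) x P -> (last x P, x, s) \in G ->
  uniq (x :: P) -> ~~ s (+) path_parity (fun u v => ~~ sgn u v) x P.
Proof.
move=> pP lP uP; have := G_neg (is_cycle_arcs pP lP uP).
by rewrite /positive_cycle /= oddD oddb arcs_of_parity => /negP; rewrite negbK.
Qed.

(** Parallel arcs of opposite signs, closed by the same path from [v] to [u], would give two cycles
    of opposite signs, one of them positive. *)
Lemma arc_sgn u v s : ((u, v, s) \in G) = adj G u v && (s == sgn u v).
Proof.
apply/idP/andP => [uvs|[/sgn_arc uvs /eqP -> //]].
have uv : adj G u v by apply/existsP; exists s.
split => //; have /connectP[P pP eu] := G_conn v u.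
case/shortenP: pP eu => Q pQ uQ _ eu.
have := cycle_parity (s := sgn u v) pQ; rewrite -eu sgn_arc // => /(_ isT uQ).
have := cycle_parity (s := s) pQ; rewrite -eu uvs => /(_ isT uQ).
by case: s {uvs} (path_parity _ _ _) (sgn u v) => [] [] [].
Qed.

(* [sbad s u v] says that the arc from u to v is negative after switching the
   vertices in s. *)
Definition sbad (s : V -> bool) : rel V := fun u v => sgn u v (+) (s u == s v).
Definition spos (s : V -> bool) : rel V := fun u v => adj G u v && ~~ sbad s u v.

(** The contributions of switching telescope, so cycles keep their parity. *)
Lemma parity_switch s x P : path_parity (fun u v => ~~ sgn u v) x P =
  path_parity (sbad s) x P (+) (s x (+) s (last x P)).
Proof.
elim: P x => /= [|y P IH] x; first by rewrite addbb.
rewrite IH /sbad; case: (sgn x y) (s x) (s y) (s (last y P)) (path_parity _ _ _) => [] [] [] [] [] //.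
Qed.

Lemma switched_cycle_parity s x P : path (adj G) x P -> adj G (last x P) x ->
  uniq (x :: P) -> sbad s (last x P) x (+) path_parity (sbad s) x P.
Proof.
move=> pP /sgn_arc lP uP; have := cycle_parity pP lP uP.
rewrite (parity_switch s) /sbad.
by case: (sgn _ x) (s x) (s (last x P)) (path_parity _ _ _) => [] [] [] [].
Qed.

Lemma pos_path s x P : path (spos s) x P ->
  path (adj G) x P /\ path_parity (sbad s) x P = false.
Proof.
elim: P x => //= y P IH x /andP[/andP[xy nb] /IH[pP wP]].
by rewrite xy (negPf nb) wP.
Qed.

Definition upds (s : V -> bool) w b : V -> bool := fun x => if x == w then b else s x.

Lemma upds_path s w b x P : w \notin x :: P ->
  path (spos (upds s w b)) x P = path (spos s) x P.
Proof.
move=> wP; apply: (@eq_in_path _ (predC1 w)).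
  by move=> u v /= uw vw; rewrite /spos /sbad /upds (negPf uw) (negPf vw).
by apply/allP => v vP /=; apply: contraNneq wP => <-.
Qed.

(** Signs are fixed from the end backwards: [x] is not on [P], so its switch is free to make the
    first arc positive. *)
Lemma switch_path x P : path (adj G) x P -> uniq (x :: P) ->
  exists s, path (spos s) x P.
Proof.
elim: P x => [|y P IH] x; first by exists xpredT.
move=> /= /andP[xy pP] /andP[xP uP]; have [s ps] := IH _ pP uP.
exists (upds s x (s y == sgn x y)); rewrite upds_path // ps andbT /spos xy /=.
have yx : y != x by apply: contraNneq xP => <-; rewrite mem_head.
rewrite /sbad /upds eqxx (negPf yx).
by case: (sgn x y) (s y) => [] [].
Qed.

(** * Switching along the closure *)

Section Switching.
Variables (i : V) (P : seq V).
Hypothesis P_cycle : is_vcycle (adj G) i P.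

(** Induction along the order of addition: a vertex outside [P] is switched to make one entering arc
    positive; for a vertex of [P] all entering arcs are shown to be positive already. *)
Lemma switch_closure L : built (ear_step (adj G) P) i L -> exists s,
  [/\ path (spos s) i P,
      forall v, v \in i :: L -> exists Q,
        [/\ path (spos s) i Q, last i Q = v & {subset Q <= i :: L}]
    & forall p u, p \in P -> p \in L -> adj G u p -> (u \in i :: L) && spos s u p].
Proof.
case: P_cycle => pP lP uP.
elim: L => [_|v L IH /= /and3P[/IH[s [sP sL sC]] vL]].
  have [s sP] := switch_path pP uP; exists s; split => // v.
  by rewrite inE => /eqP ->; exists [::].
have subL : {subset i :: L <= [:: i, v & L]}.
  by move=> x; rewrite !inE => /orP[->|->] //; rewrite !orbT.
rewrite /ear_step; case: ifP => vP; last first.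
  case/existsP => u /andP[uv uL].
  have uv' : u != v by apply: contraNneq vL => <-.
  exists (upds s v (s u == sgn u v)).
  have sL' : forall w, w \in i :: L -> exists Q, [/\ path (spos (upds s v (s u == sgn u v))) i Q,
       last i Q = w & {subset Q <= i :: L}].
    move=> w /sL[Q [pQ lQ sQ]]; exists Q; split => //; rewrite upds_path //.
    by apply: contra vL; rewrite inE => /predU1P[->|/sQ //]; rewrite mem_head.
  split.
  - rewrite upds_path // inE vP orbF; move: vL; rewrite inE; by case/norP.
  - move=> w; rewrite inE => /predU1P[->|]; first by exists [::].
    rewrite inE => /predU1P[->|wL].
      have [Q [pQ lQ sQ]] := sL' u uL; exists (rcons Q v); split.
      + rewrite rcons_path pQ lQ /spos uv /sbad /upds eqxx (negPf uv').
        by case: (sgn u v) (s u) => [] [].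
      + by rewrite last_rcons.
      + move=> x; rewrite mem_rcons inE => /predU1P[->|/sQ/subL //].
        by rewrite !inE eqxx orbT.
    have [|Q [pQ lQ sQ]] := sL' w; first by rewrite inE wL orbT.
    by exists Q; split => // x /sQ/subL.
  move=> p x pinP; rewrite inE => /predU1P[pv|pL xp]; first by rewrite -pv pinP in vP.
  have /andP[xL xpos] := sC p x pinP pL xp; rewrite subL //=.
  have pv : p != v by apply: contraNneq vL => <-; rewrite inE pL orbT.
  have xv : x != v by apply: contraNneq vL => <-.
  by move: xpos; rewrite /spos /sbad /upds (negPf pv) (negPf xv).
move=> /forallP all_in; exists s.
(* Were this arc negative, replacing the part of the cycle before [v] by a positive path from [i] to
   [u] would add exactly one negative arc and give a positive cycle. *)
have in_pos u : adj G u v -> spos s u v.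
  move=> uv; rewrite /spos uv /=; apply/negP => buv.
  have uL : u \in i :: L by have := all_in u; rewrite uv.
  have [Q0 [pQ0 lQ0 sQ0]] := sL u uL.
  have {Q0 pQ0 lQ0 sQ0} [Q [pQ uQ lQ sQ]] : exists Q, [/\ path (spos s) i Q, uniq (i :: Q),
      last i Q = u & {subset Q <= i :: L}].
    move: lQ0; case/shortenP: pQ0 => Q pQ uQ sQ lQ; exists Q; split => //.
    by move=> x /sQ/sQ0.
  case/splitPr: vP pP lP uP sP sC => P1 P2 pP lP uP sP sC.
  have [aP wP] := pos_path sP; have [aQ wQ] := pos_path pQ.
  have := switched_cycle_parity s pP lP uP; rewrite wP addbF => bl.
  (* A vertex of [P] enters only after all its in-neighbours, so [P2] is still missing; this makes
     the rerouted cycle simple. *)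
  have P2L : forall w, w \in P2 -> w \notin i :: L.
    apply: (path_outside (e := adj G) (Y := mem (i :: L)) (p := v)) => //.
      by move: pP; rewrite cat_path /= => /and3P[].
    move=> w y wP2 wL yw; have wPP : w \in P1 ++ v :: P2 by rewrite mem_cat inE wP2 !orbT.
    case: (andP (sC w y wPP _ yw)) => //; move: wL; rewrite /= inE => /predU1P[wi|//].
    by move: uP; rewrite /= -wi wPP.
  have := @switched_cycle_parity s i (Q ++ v :: P2).
  move: aP lP bl; rewrite !cat_path !last_cat /= lQ uv aQ => /and3P[_ _ ->] -> bl.
  rewrite path_parity_cat wQ /= lQ buv; move: wP; rewrite path_parity_cat /=.
  move: (sP); rewrite cat_path /= => /and3P[/pos_path[_ ->] /andP[_ /negPf ->] _] /= ->.
  rewrite bl /= => /(_ isT isT) H.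
  apply: notF; apply: H.
  move: uQ uP; rewrite /= !mem_cat !negb_or cat_uniq [uniq (Q ++ _)]cat_uniq.
  move=> /andP[-> ->] /andP[/andP[_ ->] /and3P[_ _ ->]] /=.
  rewrite andbT negb_or; apply/andP; split; first by apply: contra vL => /sQ.
  by apply/hasPn => w /P2L; apply: contra => /sQ.
split => //.
  move=> w; rewrite inE => /predU1P[->|]; first by exists [::].
  rewrite inE => /predU1P[->|wL]; last first.
    have [|Q [pQ lQ sQ]] := sL w; first by rewrite inE wL orbT.
    by exists Q; split => // x /sQ/subL.
  have [u uv] : exists u, adj G u v.
    have vi : v != i by move: vL; rewrite inE => /norP[].
    exact: (has_pred G_conn vi).
  have uL : u \in i :: L by have := all_in u; rewrite uv.
  have [Q [pQ lQ sQ]] := sL u uL; exists (rcons Q v); split.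
  + by rewrite rcons_path pQ lQ in_pos.
  + by rewrite last_rcons.
  + move=> x; rewrite mem_rcons inE => /predU1P[->|/sQ/subL //].
    by rewrite !inE eqxx orbT.
move=> p u pinP; rewrite inE => /predU1P[-> uv|pL up].
  by rewrite in_pos // subL //; have := all_in u; rewrite uv.
by have /andP[/subL -> ->] := sC p u pinP pL up.
Qed.

Lemma switching L : built (ear_step (adj G) P) i L -> (forall v, v \in i :: L) ->
  exists s, [/\ path (spos s) i P, forall v, connect (spos s) i v
    & forall p u, p \in P -> adj G u p -> spos s u p].
Proof.
move=> bL fL; have [s [sP sL sC]] := switch_closure bL; exists s; split => //.
  by move=> v; have [Q [pQ <- _]] := sL v (fL v); apply/connectP; exists Q.
move=> p u pP up; have := fL p; rewrite inE => /predU1P[pi|pL].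
  by case: P_cycle => _ _; rewrite /= -pi pP.
by have /andP[] := sC p u pP pL up.
Qed.

End Switching.
End Signs.

(** * And-or-nets *)

(** With [t v] true this is the conjunction of the literals at [v]; with [t v] false it says that
    not all literals are false, which is the disjunction. *)
Definition net n (G : sdigraph n) (t : 'I_n -> bool) : BN n := fun x =>
  [ffun v => [forall u, forall s, ((u, v, s) \in G) ==> (x u == (s == t v))] == t v].

Section Net.
Variables (n : nat) (G : sdigraph n) (t : 'I_n -> bool).

Lemma net_type v : is_conjunction G (net G t) v \/ is_disjunction G (net G t) v.
Proof.
case tv : (t v); [left | right] => x; rewrite ffunE tv; split.
- rewrite eqb_id => /forallP H j s jv.
  by have /forallP/(_ s) := H j; rewrite jv /= eqb_id => /eqP.
- move=> H; rewrite eqb_id; apply/forallP => u; apply/forallP => s.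
  by apply/implyP => /H ->; rewrite eqb_id.
- move=> /negbT; rewrite eqbF_neg negbK => /forallP H j s jv.
  by have /forallP/(_ s) := H j; rewrite jv /= eqbF_neg => /eqP.
- move=> H; apply/negbTE; rewrite eqbF_neg negbK; apply/forallP => u; apply/forallP => s.
  by apply/implyP => /H ->; rewrite eqbF_neg.
Qed.

Hypothesis arc_unique : forall u v s s', (u, v, s) \in G -> (u, v, s') \in G -> s = s'.

Lemma net_on : BN_on G (net G t).
Proof.
move=> j v s; split.
  (* Inputs other than [j] get the neutral value of their literal, so the value at [v] depends on
     [j] alone. *)
  move=> jv; pose x : config n :=
    [ffun u => (u != j) && ((u, v, t v) \in G)].
  have xj : x j = false by rewrite ffunE eqxx.
  exists x; split => //.
  have all_other b : b = (s == t v) ->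
    [forall u, forall s', ((u, v, s') \in G) ==> (setc x j b u == (s' == t v))].
    move=> ->; apply/forallP => u; apply/forallP => s'; apply/implyP => uv.
    rewrite !ffunE; have [uj|uj /=] := eqVneq u j.
      by move: uv; rewrite uj => /(arc_unique jv) ->.
    apply/eqP; apply/idP/eqP => [uv'|<- //]; exact: (arc_unique uv uv').
  have not_all b : b = (s != t v) ->
    [forall u, forall s', ((u, v, s') \in G) ==> (setc x j b u == (s' == t v))] = false.
    move=> ->; apply/negP => /forallP/(_ j)/forallP/(_ s); rewrite jv !ffunE eqxx.
    by case: (s == t v).
  have x_id : setc x j false = x.
    by apply/ffunP => u; rewrite ffunE; case: eqP => // ->; rewrite xj.
  have fx b : b = (s == t v) -> net G t (setc x j b) v = t v.
    by move=> eb; rewrite ffunE all_other // eqb_id.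
  have fx' b : b = (s != t v) -> net G t (setc x j b) v = ~~ t v.
    by move=> eb; rewrite ffunE not_all // eqbF_neg.
  case est : (s == t v).
    have := fx true; have := fx' false; rewrite x_id est => -> // -> //.
    by move/eqP: est => ->; case: (t v).
  have := fx' true; have := fx false; rewrite x_id est => -> // -> //.
  by move: est; case: (t v); case: (s).
move=> [x [xj]].
case: (boolP [exists s, (j, v, s) \in G]) => [/existsP[s' js']|nG]; last first.
  have -> : net G t (setc x j true) v = net G t x v.
    rewrite !ffunE; congr (_ == _); apply: eq_forallb => u; apply: eq_forallb => s'.
    have [uj|uj] := eqVneq u j; last by rewrite ffunE (negPf uj).
    case us : ((u, v, s') \in G) => //=.
    by case/negP: nG; apply/existsP; exists s'; rewrite -uj.
  by case: s; case: (net G t x v).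
suff imp : (if s then (net G t x v == false) && (net G t (setc x j true) v == true)
    else (net G t x v == true) && (net G t (setc x j true) v == false)) -> s = s'.
  by move/imp ->.
rewrite !ffunE; set A := [forall u, _]; set B := [forall u, _].
have hA : A -> false = (s' == t v).
  by move/forallP/(_ j)/forallP/(_ s'); rewrite js' xj => /eqP.
have hB : B -> true = (s' == t v).
  by move/forallP/(_ j)/forallP/(_ s'); rewrite js' !ffunE eqxx => /eqP.
move: hA hB; case: A; case: B; case: s; case: s' {js'}; case: (t v) => //= hA hB;
  by (have := hA isT) || (have := hB isT).
Qed.

Lemma net_and_or : and_or_net G (net G t).
Proof. by split; [apply: net_on | move=> i; apply: net_type]. Qed.

End Net.

(** * The synchronizing word *)

Section Dynamics.
Variables (n : nat) (G : sdigraph n).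
Hypotheses (G_conn : strongly_connected G) (G_neg : no_positive_cycle G).
Variables (i : 'I_n) (P : seq 'I_n) (s : 'I_n -> bool).
Hypotheses (P_cycle : is_vcycle (adj G) i P) (P_pos : path (spos G s) i P).
Hypothesis pos_conn : forall v, connect (spos G s) i v.
Hypothesis P_in_pos : forall p u, p \in P -> adj G u p -> spos G s u p.
Local Notation V := 'I_n.
Local Notation pos := (spos G s).
Local Notation bad := (sbad G s).
Local Notation adj := (adj G).

Lemma path_pos_uniq u v : connect pos u v ->
  exists Q, [/\ path adj u Q, path_parity bad u Q = false, last u Q = v, uniq (u :: Q)
    & forall w, w \in u :: Q -> connect pos u w /\ connect pos w v].
Proof.
case/connectP => Q0 pQ0; case/shortenP: pQ0 => Q pQ uQ _ ev.
have [aQ wQ] := pos_path pQ; exists Q; split => // w.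
rewrite ev => wQ'; split; first exact: (path_connect pQ wQ').
case/splitPl: wQ' pQ => Q1 Q2 <-; rewrite cat_path last_cat => /andP[_ pQ2].
by apply/connectP; exists Q2.
Qed.

(** A positive path from [i] to [u] closed by a positive arc would be a positive cycle. *)
Lemma root_in_bad u : adj u i -> bad u i.
Proof.
move=> ui; have [Q [pQ wQ lQ uQ _]] := path_pos_uniq (pos_conn u).
have := switched_cycle_parity G_neg s pQ.
by rewrite lQ wQ addbF => /(_ ui uQ).
Qed.

Lemma root_in_pos u : pos u i = false.
Proof. by apply/negP => /andP[/root_in_bad ->]. Qed.

Lemma pos_acyclic u v : pos u v -> ~~ connect pos v u.
Proof.
move=> /andP[uv nb]; apply/negP => /path_pos_uniq[Q [pQ wQ lQ uQ _]].
have := switched_cycle_parity G_neg s pQ.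
by rewrite lQ wQ addbF (negPf nb) => /(_ uv uQ).
Qed.

Lemma connect_pos_anti u v : connect pos u v -> connect pos v u -> u = v.
Proof.
case/connectP => [[_ -> //|w Q]] /= /andP[uw pQ] -> vu.
case/negP: (pos_acyclic uw); apply: connect_trans vu; apply/connectP; by exists Q.
Qed.

Lemma pos_pred v : v != i -> exists u, pos u v.
Proof.
have /connectP[Q pQ ->] := pos_conn v.
case/lastP: Q pQ => [|Q w] /=; first by rewrite eqxx.
by rewrite rcons_path last_rcons => /andP[_ ew] _; exists (last i Q).
Qed.

Definition back v := [exists j, connect pos v j && adj j i].

Lemma back_pos u v : pos u v -> back v -> back u.
Proof.
move=> uv /existsP[j /andP[vj ji]]; apply/existsP; exists j; rewrite ji andbT.
exact: connect_trans (connect1 uv) vj.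
Qed.

(* Otherwise the positive paths i ~> q and r ~> j, j -> i, are disjoint and,
   together with the bad arcs q -> r and j -> i, form a positive cycle. *)
Lemma bad_into_back q r : back r -> adj q r -> bad q r -> connect pos r q.
Proof.
move=> /existsP[j /andP[rj ji]] qr bqr.
have [Q [pQ wQ lQ uQ sQ]] := path_pos_uniq (pos_conn q).
have [R [pR wR lR uR sR]] := path_pos_uniq rj.
case: (boolP (has (mem (i :: Q)) (r :: R))) => [/hasP[w wR' wQ']|disj].
  exact: connect_trans (sR w wR').1 (sQ w wQ').2.
have := @switched_cycle_parity _ _ G_neg s i (Q ++ r :: R).
rewrite cat_path last_cat path_parity_cat /= lQ lR pQ qr pR wQ bqr wR root_in_bad //=.
by rewrite -[_ && uniq _]/(uniq ((i :: Q) ++ r :: R)) cat_uniq uQ disj uR => /(_ isT ji isT).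
Qed.

Lemma P_back p : p \in P -> back p.
Proof.
case: P_cycle => _ lP _ pP; apply/existsP; exists (last i P); rewrite lP andbT.
case/splitPr: pP P_pos => P1 P2; rewrite cat_path last_cat /= => /and3P[_ _ p2].
by apply/connectP; exists P2.
Qed.

(** * Topological orders of the positive arcs *)

Definition topo_step (Y : seq V) v := [forall u, pos u v ==> (u \in Y)].
Local Notation topo := (built topo_step i).

Lemma topo_closed L : topo L -> forall v u, v \in i :: L -> connect pos u v -> u \in i :: L.
Proof.
move=> tL; suff H v u : v \in i :: L -> pos u v -> u \in i :: L.
  move=> v u + /connectP[Q]; elim: Q u => /= [u vL _ <- //|w Q IH u vL /andP[uw pQ] ev].
  exact: H (IH w vL pQ ev) uw.
elim: L tL => [_|w L IH /= /and3P[tL wL /forallP sw]].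
  by rewrite inE => /eqP ->; rewrite root_in_pos.
move=> vL uv; suff: u \in i :: L by rewrite !inE => /orP[->|->] //; rewrite !orbT.
move: vL; rewrite inE => /predU1P[vi|]; first by rewrite vi root_in_pos in uv.
rewrite inE => /predU1P[vw|vL]; last by apply: IH; rewrite // inE vL orbT.
by have := sw u; rewrite -vw uv.
Qed.

(** Were the construction stuck, a missing vertex with fewest positive ancestors would have a
    missing positive in-neighbour, which by acyclicity has strictly fewer. *)
Lemma topo_exists : exists2 L, topo L & forall v, v \in i :: L.
Proof.
have [L tL sL] := built_maximal topo_step i; exists L => // v.
apply/negPn/negP => vL.
have := @arg_minnP _ v (fun w => w \notin i :: L) (fun w => #|[pred u | connect pos u w]|) vL.
case=> w wL wmin; have /forallPn[u] := sL w wL; rewrite negb_imply => /andP[uw uL].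
have := wmin u uL; rewrite leqNgt; case/negP; apply/proper_card/properP; split.
  apply/subsetP => x; rewrite !inE => xu; exact: connect_trans xu (connect1 uw).
by exists w; rewrite !inE ?connect0 // pos_acyclic.
Qed.

Lemma topo_filter (B : pred V) L : (forall u v, pos u v -> B v -> B u) ->
  topo L -> topo (filter B L).
Proof.
move=> Bcl; elim: L => //= v L IH /and3P[/IH tL vL /forallP sv].
case Bv : (B v) => //=; rewrite tL /=; apply/andP; split.
  by apply: contra vL; rewrite !inE mem_filter => /orP[->|/andP[_ ->]] //; rewrite orbT.
apply/forallP => u; apply/implyP => uv; have := sv u; rewrite uv !inE mem_filter.
by rewrite (Bcl u v uv Bv).
Qed.

(* After switching, the vertices of P become disjunctions and all other
   vertices, i included, become conjunctions. *)
Definition and_or_type v := (v \in P) == s v.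
Local Notation f := (net G and_or_type).

(** * The net in switched coordinates *)

Definition on v (x : config n) := x v (+) s v.

(** By De Morgan, flipping the value of a vertex exchanges conjunction and disjunction; hence
    [and_or_type] compares membership in [P] with [s]. *)
Lemma on_upd v x : on v (upd f v x) =
  ([forall u, adj u v ==> (on u x == bad u v (+) (v \notin P))] == (v \notin P)).
Proof.
rewrite /on /upd !ffunE eqxx.
have -> : [forall u, forall s', ((u, v, s') \in G) ==> (x u == (s' == and_or_type v))] =
    [forall u, adj u v ==> (on u x == bad u v (+) (v \notin P))].
  apply: eq_forallb => u.
  have E : (on u x == bad u v (+) (v \notin P)) = (x u == (sgn G u v == and_or_type v)).
    rewrite /on /sbad /and_or_type.
    by case: (v \in P) (x u) (s u) (s v) (sgn G u v) => [] [] [] [] [].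
  rewrite E; apply/forallP/implyP => [H /(sgn_arc (G := G)) uv|H s'].
    by have := H (sgn G u v); rewrite uv.
  by rewrite (arc_sgn G_conn G_neg); apply/implyP => /andP[/H + /eqP ->].
by rewrite /and_or_type; case: (v \in P) (s v) [forall u, _] => [] [] [].
Qed.

Lemma on_upd_neq u v x : u != v -> on u (upd f v x) = on u x.
Proof. by rewrite /on /upd ffunE => /negPf ->. Qed.

Lemma on_or v x : v \in P -> on v (upd f v x) = [exists u, adj u v && on u x].
Proof.
move=> vP; rewrite on_upd vP /= eqbF_neg negb_forall; apply: eq_existsb => u.
rewrite negb_imply; case uv : (adj u v) => //=.
by have /andP[_ /negPf ->] := P_in_pos vP uv; rewrite /= eqbF_neg negbK.
Qed.

Lemma off_and u v x : v \notin P -> adj u v -> on u x = bad u v -> ~~ on v (upd f v x).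
Proof.
move=> vP uv e; rewrite on_upd vP; apply/negP => /eqP/forallP/(_ u).
by rewrite uv e; case: (bad u v).
Qed.

Lemma on_and v x : v \notin P -> (forall u, adj u v -> on u x = ~~ bad u v) ->
  on v (upd f v x).
Proof.
move=> vP H; rewrite on_upd vP; apply/eqP/forallP => u; apply/implyP => /H ->.
by rewrite addbT.
Qed.

Lemma root_notin : i \notin P. Proof. by case: P_cycle => _ _ /andP[]. Qed.

Lemma root_off u x : adj u i -> on u x -> ~~ on i (upd f i x).
Proof. by move=> ui ux; apply: (off_and root_notin ui); rewrite root_in_bad. Qed.

(** [L] lists the latest vertex first, so the reversal updates in topological order. *)
Definition sweep L := upd_word f (rev L).

Lemma sweep_cons v L x : sweep (v :: L) x = upd f v (sweep L x).
Proof. by rewrite /sweep /upd_word rev_cons -cats1 foldl_cat. Qed.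

Lemma sweep_notin L u x : u \notin L -> on u (sweep L x) = on u x.
Proof.
elim: L => [|v L IH] //; rewrite inE negb_or sweep_cons => /andP[uv uL].
by rewrite on_upd_neq // IH.
Qed.

(** A vertex of [P] has only positive entering arcs, all from vertices already off; any other vertex
    has at least one such arc, enough to falsify its conjunction. *)
Lemma sweep_off L x : topo L -> ~~ on i x -> forall v, v \in i :: L -> ~~ on v (sweep L x).
Proof.
move=> + offi; elim: L => [_ v|w L IH /= /and3P[/IH H wL /forallP sw] v].
  by rewrite inE => /eqP ->.
rewrite sweep_cons; have [-> _|vw] := eqVneq v w; last first.
  by rewrite on_upd_neq //; move: vw; rewrite !inE => /negPf -> /H.
have inL u : pos u w -> ~~ on u (sweep L x) by move=> uw; apply: H; have := sw u; rewrite uw.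
case: (boolP (w \in P)) => wP.
  rewrite on_or //; apply/negP => /existsP[u /andP[uw]]; apply/negP/inL.
  exact: P_in_pos.
have [u uw] : exists u, pos u w by apply: pos_pred; move: wL; rewrite inE => /norP[].
move: (inL u uw); case/andP: uw => uw nb offu; apply: (off_and wP uw).
by rewrite (negPf offu) (negPf nb).
Qed.

Lemma P_pred p : p \in P -> exists2 u, u \in i :: P & adj u p.
Proof.
case: P_cycle => pP _ _ pinP; case/splitPr: pinP pP => P1 P2; rewrite cat_path /=.
move=> /and3P[_ e _]; exists (last i P1) => //.
by have := mem_last i P1; rewrite !inE mem_cat => /orP[->|->] //; rewrite orbT.
Qed.

Lemma sweep_on_P L x : topo L -> on i x ->
  forall p, p \in P -> p \in L -> on p (sweep L x).
Proof.
move=> + oni; elim: L => //= w L IH /and3P[tL wL /forallP sw] p pP pL.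
rewrite sweep_cons; have [pw|pw] := eqVneq p w; last first.
  by rewrite on_upd_neq //; apply: IH => //; move: pL; rewrite inE (negPf pw).
rewrite -pw on_or //; have [u uP up] := P_pred pP.
apply/existsP; exists u; rewrite up /=.
have uL : u \in i :: L by have := sw u; rewrite -pw P_in_pos.
have iL : i \notin L by have := built_uniq tL => /andP[].
move: uP uL; rewrite !inE => /predU1P[-> _|uP]; first by rewrite sweep_notin.
by case/predU1P => [ui|]; [move: uP root_notin; rewrite ui => -> | apply: IH].
Qed.

Lemma sweep_on_back L x : topo L -> on i x -> (forall v, v != i -> ~~ on v x) ->
  forall v, v \in i :: L -> back v -> on v (sweep L x).
Proof.
move=> + oni offx; elim: L => [_ v|w L IH /= tL v].
  by rewrite inE => /eqP ->.
have /and3P[tL' wL /forallP sw] := tL.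
rewrite sweep_cons; have [-> _ wB|vw] := eqVneq v w; last first.
  by rewrite on_upd_neq //; move: vw; rewrite !inE => /negPf -> /(IH tL').
have inL u : pos u w -> on u (sweep L x).
  by move=> uw; apply: IH => //; [have := sw u; rewrite uw | apply: back_pos wB].
case: (boolP (w \in P)) => wP.
  have [u _ uw] := P_pred wP; rewrite on_or //; apply/existsP; exists u.
  by rewrite uw inL // P_in_pos.
apply: on_and => // u uw; case: (boolP (bad u w)) => b; last by rewrite inL // /spos uw.
(* A negative arc into [w] comes from a positive descendant of [w], not yet swept and hence still
   off. *)
have wu := bad_into_back wB uw b; apply/negbTE.
have uL : u \notin i :: L.
  by apply: contra wL => uL; apply: (topo_closed tL' uL wu).
move: uL; rewrite inE => /norP[ui uL].
by rewrite sweep_notin // offx.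
Qed.

Lemma walk_on Q a x : path adj a Q -> {subset Q <= P} -> on a x ->
  on (last a Q) (upd_word f Q x).
Proof.
elim: Q a x => //= q Q IH a x /andP[aq pQ] sQ ona; apply: IH => //.
  by move=> w wQ; apply: sQ; rewrite inE wQ orbT.
by rewrite on_or ?sQ ?mem_head //; apply/existsP; exists a; rewrite aq.
Qed.

Lemma root_flip x : (forall v, ~~ on v x) ->
  on i (upd f i x) /\ forall v, v != i -> ~~ on v (upd f i x).
Proof.
move=> offx; split; last by move=> v vi; rewrite on_upd_neq.
apply: on_and; first exact: root_notin.
by move=> u ui; rewrite root_in_bad // (negPf (offx u)).
Qed.

(** [Q] is the part of [P] from [p] on; it is empty when [p] is [i], whose in-neighbours act on it
    directly. *)
Lemma suffix_to_root p : p \in i :: P -> exists Q,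
  [/\ {subset Q <= P}, size Q < n
    & forall a, adj a p -> path adj a Q /\ adj (last a Q) i].
Proof.
have sizeP : size P < n.
  case: P_cycle => _ _ /card_uniqP /= <-.
  by have := max_card (mem (i :: P)); rewrite card_ord.
rewrite inE => /predU1P[->|pP].
  by exists [::]; split => //; exact: leq_ltn_trans sizeP.
case: P_cycle; case/splitPr: pP sizeP => P1 P2 sizeP pP lP _.
exists (p :: P2); split.
- by move=> w wP; rewrite mem_cat wP orbT.
- by apply: leq_ltn_trans sizeP; rewrite size_cat leq_addl.
- move=> a ap; move: pP lP; rewrite cat_path last_cat /= ap => /and3P[_ _ ->].
  by [].
Qed.

Lemma synchronizing_and_or_net p a b : p \in i :: P -> adj a p -> adj b p -> a != b ->
  exists w, synchronizing f w /\ size w <= 5 * n.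
Proof.
move=> pP; wlog nab : a b / ~~ connect pos a b => [H|] ap bp ab.
  case: (boolP (connect pos a b)) => [cab|nab]; last exact: (H a b).
  apply: (H b a) => //; last by rewrite eq_sym.
  by apply: contra ab => cba; rewrite (connect_pos_anti cab cba).
have [L tL fL] := topo_exists; pose B u := connect pos u b.
have BL : topo (filter B L).
  by apply: topo_filter tL => u v uv; apply: connect_trans (connect1 uv).
have [Q [sQ szQ pQ]] := suffix_to_root pP.
have iL : i \notin L by have := built_uniq tL => /andP[].
have iQ : i \notin Q by apply: contra root_notin => /sQ.
have szL : size L < n by have := built_size tL; rewrite card_ord.
have vL v : v != i -> v \in L by move: (fL v); rewrite inE => /orP[->|].
have back_in u : adj u p -> back u.
  move=> up; move: pP; rewrite inE => /predU1P[pi|pP].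
    by apply/existsP; exists u; rewrite connect0 -pi.
  exact: back_pos (P_in_pos pP up) (P_back pP).
pose finish x := sweep L (upd f i (upd_word f Q x)).
have finish_off x c : adj c p -> on c x -> forall v, ~~ on v (finish x).
  move=> cp onc v; have [pcQ lcQ] := pQ c cp.
  apply: sweep_off => //; apply: (root_off lcQ); exact: walk_on.
pose w := rev L ++ i :: rev L ++ i :: rev (filter B L) ++ Q ++ i :: rev L.
have wE x : upd_word f w x =
    finish (sweep (filter B L) (upd f i (sweep L (upd f i (sweep L x))))).
  by rewrite /w /finish /sweep /upd_word !foldl_cat /= !foldl_cat /= !foldl_cat.
exists w; split; last first.
  rewrite /w !size_cat /= !size_cat /= !size_cat /= !size_rev.
  have sB : size (filter B L) <= size L by rewrite size_filter count_size.
  (* Four sweeps and [Q], each of at most n - 1 letters, and three updates of [i] make at most 5n -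
     2. *)
  have arith l q c : l < n -> q < n -> c <= l ->
      l + (l + (c + (q + l.+1)).+1).+1 <= 5 * n by clear; lia.
  exact: arith szL szQ sB.
exists [ffun v => s v] => x; rewrite wE; apply/ffunP => v.
suff: ~~ on v (finish (sweep (filter B L) (upd f i (sweep L (upd f i (sweep L x)))))).
  by rewrite /on ffunE; case: (_ v) (s v) => [] [].
case oni : (on i x).
(* The first sweep turns the end of [P] on, so [i] goes off; the second clears everything, [i] alone
   comes on, and the restricted sweep reaches [b]. *)
- have last_on : on (last i P) (sweep L x).
    have := mem_last i P; rewrite inE => /predU1P[->|lP]; first by rewrite sweep_notin.
    apply: sweep_on_P => //; apply: vL; by apply: contraNneq root_notin => <-.
  have lPi : adj (last i P) i by case: P_cycle.
  have off2 := sweep_off tL (root_off lPi last_on).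
  have [on3 off3] := root_flip (fun v => off2 v (fL v)).
  apply: (finish_off _ b) => //; apply: (sweep_on_back BL on3 off3); last exact: back_in.
  by rewrite inE mem_filter /B connect0 /= -in_cons.
(* Here everything happens one sweep earlier: the second sweep turns [a] on, and the restricted one
   leaves [a] alone, as it is not a positive ancestor of [b]. *)
- have off1 := sweep_off tL (negbT oni).
  have [on2 off2] := root_flip (fun v => off1 v (fL v)).
  have on3 := sweep_on_back tL on2 off2.
  have ai : a != i by apply: contraNneq nab => ->; exact: pos_conn.
  apply: (finish_off _ a) => //.
  rewrite sweep_notin; last by rewrite mem_filter negb_and /B nab.
  by rewrite on_upd_neq //; apply: on3 => //; exact: back_in.
Qed.

End Dynamics.

(** * Assembling the theorem *)

Section Main.
Variables (n : nat) (G : sdigraph n).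
Hypotheses (G_conn : strongly_connected G) (G_neg : no_positive_cycle G).

Lemma vcycle_exists a : a \in G -> exists i P, is_vcycle (adj G) i P.
Proof.
case: a => [[u v] s] uvs; have uv : adj G u v by apply/existsP; exists s.
have /connectP[P0 pP0] := G_conn v u; case/shortenP: pP0 => P pP uP _ eu.
by exists v, P; split; rewrite -?eu.
Qed.

(** If every vertex of the cycle had only its cycle predecessor as in-neighbour, walking backwards
    from [i] would never leave the cycle, and [G] would be that cycle. *)
Lemma two_preds i P : is_vcycle (adj G) i P -> ~ graph_is_cycle G ->
  exists p a b, [/\ p \in i :: P, adj G a p, adj G b p & a != b].
Proof.
move=> [pP lP uP] nc.
case: (pickP [pred t : 'I_n * 'I_n * 'I_n | [&& t.1.1 \in i :: P, adj G t.1.2 t.1.1,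
    adj G t.2 t.1.1 & t.1.2 != t.2]]) => [[[p a] b] /and4P[/= pP' ap bp ab]|all_eq].
  by exists p, a, b.
have one_pred p u v : p \in i :: P -> adj G u p -> adj G v p -> u = v.
  move=> pP' up vp; have := all_eq (p, u, v); rewrite /= pP' up vp /=.
  by move/negbFE/eqP.
have cyc p u : p \in i :: P -> adj G u p -> (u, p, sgn G u p) \in
    (last i P, i, sgn G (last i P) i) :: arcs_of G i P /\ u \in i :: P.
  rewrite inE => /predU1P[->|pinP] up.
    by rewrite (one_pred i u (last i P)) ?mem_head // mem_last.
  case/splitPr: pinP pP {lP uP nc all_eq} one_pred => P1 P2.
  rewrite cat_path /= => /and3P[_ e _] one_pred.
  have -> : u = last i P1.
    by apply: (one_pred p) => //; rewrite !inE mem_cat mem_head !orbT.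
  split; first by rewrite /arcs_of pairmap_cat inE mem_cat /= mem_head !orbT.
  by have := mem_last i P1; rewrite !inE mem_cat => /orP[->|->] //; rewrite orbT.
have all_in v : v \in i :: P.
  have /connectP[Q pQ ei] := G_conn v i.
  elim: Q v pQ ei => /= [v _ <-|w Q IH v /andP[vw pQ] ei]; first exact: mem_head.
  by case: (cyc w v (IH w pQ ei) vw).
case: nc; exists ((last i P, i, sgn G (last i P) i) :: arcs_of G i P).
have isc := is_cycle_arcs pP (sgn_arc lP) uP; split => //.
- apply/setP => -[[u v] s]; rewrite [RHS]inE; apply/idP/idP => [|c].
    rewrite (arc_sgn G_conn G_neg) => /andP[uv /eqP ->].
    by case: (cyc v u (all_in v) uv).
  by case: isc => _ /allP/(_ _ c).
- move=> v; rewrite /= arcs_of_tails -[_ :: belast _ _]/(last i P :: _).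
  by have := all_in v; rewrite lastI mem_rcons.
Qed.

End Main.

(* length <= 5 n (sqrt 2)^n  is stated as  length^2 <= 25 n^2 2^n  (both sides >= 0) *)
Theorem theorem2 (n : nat) (G : sdigraph n) :
  strongly_connected G -> no_positive_cycle G -> ~ graph_is_cycle G ->
  exists (f : BN n) (w : seq 'I_n),
    [/\ and_or_net G f, synchronizing f w & (size w) ^ 2 <= 25 * n ^ 2 * 2 ^ n].
Proof.
move=> G_conn G_neg nc.
have arc_unique u v s s' : (u, v, s) \in G -> (u, v, s') \in G -> s = s'.
  by rewrite !(arc_sgn G_conn G_neg) => /andP[_ /eqP ->] /andP[_ /eqP ->].
suff [t [w [sw le]]] : exists t w, synchronizing (net G t) w /\ size w <= 5 * n.
  exists (net G t), w; split => //; first exact: net_and_or.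
  (* The factor 2^n only has to be at least 1. *)
  apply: leq_trans (leq_pmulr _ _); last by rewrite expn_gt0.
  by rewrite -[25]/(5 ^ 2) -expnMn leq_exp2r.
case: (set_0Vmem G) => [G0|[a aG]].
  (* Without arcs every conjunction is empty, hence constantly true, and updating each vertex once
     synchronizes. *)
  exists xpredT, (enum 'I_n); split; last by rewrite size_enum_ord leq_pmull.
  exists [ffun=> true] => x; apply/ffunP => v; rewrite ffunE.
  have : v \in enum 'I_n by rewrite mem_enum.
  elim/last_ind: (enum _) => //= r k IH.
  rewrite /upd_word -cats1 foldl_cat /= -[foldl _ _ _]/(upd_word _ r x) mem_cat inE.
  rewrite /upd !ffunE; case: eqP => [_ _|_]; last by rewrite orbF => /IH.
  by rewrite eqb_id; apply/forallP => u; apply/forallP => s; rewrite G0 inE.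
have [i0 [P0 c0]] := vcycle_exists G_conn aG.
have [i [P [L [cP bL fL]]]] := complete_closure G_conn c0.
have [s [sP s_conn sC]] := switching G_conn G_neg cP bL fL.
have [p [a' [b [pP ap bp ab]]]] := two_preds G_conn G_neg cP nc.
have [w H] := synchronizing_and_or_net G_conn G_neg cP sP s_conn sC pP ap bp ab.
by exists (and_or_type P s), w.
Qed.
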